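(* Let $I\subset\mathbf{\Delta}$, let $\mathbf{L}=\mathbf{L}_I$ be the corresponding standard Levi subgroup of $\mathbf{GL}_n$, and let $w\in\mathbf{S}_n^d$ be a non-identity Grassmann permutation, written in one-line notation as $$w=(a_1\; a_1+1\,\dots\, a_1+b_1\;\; a_2\; a_2+1\,\dots\, a_2+b_2\;\dots\; a_j\; a_j+1\,\dots\, a_j+b_j\;\; w_{d+1}\dots w_n),$$ where $a_\ell+b_\ell+1<a_{\ell+1}$ for $1\leq\ell<j$. Assume that the Schubert variety $X_{w\mathbf{Q}_d}\subseteq\mathbf{GL}_n/\mathbf{Q}_d$ is $\mathbf{L}$-stable. If $X_{w\mathbf{Q}_d}$ is a toroidal $\mathbf{L}$-variety, then for every Schubert divisor $X_{w_\ell\mathbf{Q}_d}$ of $X_{w\mathbf{Q}_d}$ one of the following two criteria is satisfied: \begin{enumerate} \item $a_\ell-1\in\mathbf{\Delta}\setminus I$, or \item $a_\ell-1\notin\mathbf{\Delta}\setminus I$ and there exist no $\mathbf{L}_I$-stable Schubert subvarieties in $X_{w_\ell\mathbf{Q}_d}$. \end{enumerate}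
   Context: Work over $\mathbb{C}$. $\mathbf{B}_n$ and $\mathbf{T}_n$ are the upper triangular matrices and the diagonal torus in $\mathbf{GL}_n$, and $\mathbf{\Delta}=\{\alpha_1,\dots,\alpha_{n-1}\}$ is the corresponding set of simple roots in standard order; subsets of $\mathbf{\Delta}$ are identified with sets of indices in $\{1,\dots,n-1\}$. For $I\subset\mathbf{\Delta}$, $\mathbf{L}_I\supset\mathbf{T}_n$ is the standard Levi factor of the standard parabolic subgroup (containing $\mathbf{B}_n$) whose simple roots are $I$. $\mathbf{Q}_d$ is the standard maximal parabolic subgroup corresponding to $\mathbf{\Delta}\setminus\{\alpha_d\}$, so $\mathbf{GL}_n/\mathbf{Q}_d\cong\mathbf{Gr}(d,n)$. $\mathbf{S}_n^d$ is the set of permutations $w=(w_1\dots w_n)$ (one-line notation) of $\{1,\dots,n\}$ with $w_1<\dots<w_d$ and $w_{d+1}<\dots<w_n$. $X_{w\mathbf{Q}_d}$ is the Zariski closure of $\mathbf{B}_nw\mathbf{Q}_d/\mathbf{Q}_d$; a Schubert divisor of it is a Schubert subvariety of codimension one. In the displayed notation, the first $d$ entries of $w$ are grouped into maximal runs of consecutive integers with $b_\ell\geq 0$. For $1\leq\ell\leq j$ with $a_\ell>1$, $w_\ell\in\mathbf{S}_n^d$ is the permutation obtained from $w$ by replacing the entry $a_\ell$ among the first $d$ entries by $a_\ell-1$ (i.e. exchanging the values $a_\ell-1$ and $a_\ell$); the Schubert divisors of $X_{w\mathbf{Q}_d}$ are of the form $X_{w_\ell\mathbf{Q}_d}$. For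 a connected reductive group $H$ with Borel subgroup $B_H$, a spherical $H$-variety is a normal $H$-variety with an open $B_H$-orbit; it is toroidal if no $B_H$-stable prime divisor that is not $H$-stable contains an $H$-orbit. Groups act by left multiplication. *)

(* Defs.v *)
From mathcomp Require Export all_boot all_order all_algebra all_fingroup.
From mathcomp Require Export boolp classical_sets reals.
From mathcomp Require Export complex mpoly.

Set Implicit Arguments.
Unset Strict Implicit.
Unset Printing Implicit Defensive.

(* The field of complex numbers is R[i] for R : realType. *)

Local Open Scope classical_set_scope.
Local Open Scope ring_scope.

(* Simple roots are indexed from 1, as alpha_1, ..., alpha_{n-1}; rows and
   columns of matrices, and the letters permuted by 'S_n, are indexed from 0. *)
Definition Delta (n : nat) : set nat := [set k | (0 < k < n)%N].

Section Groups.
Variables (R : realType) (n : nat).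
Implicit Type I : set nat.

Definition GL : set 'M[R[i]]_n := [set g | g \in unitmx].

Definition borel : set 'M[R[i]]_n :=
  [set g | GL g /\ forall r c : 'I_n, (c < r)%N -> g r c = 0].

(* For c < r, the entry (r, c) is the root space of
   -(alpha_{c+1} + ... + alpha_r), which lies in the standard parabolic
   subgroup exactly when all these simple roots belong to I. *)
Definition parabolic I : set 'M[R[i]]_n :=
  [set g | GL g /\ forall r c : 'I_n, (c < r)%N ->
     (exists2 k, (c < k <= r)%N & ~ I k) -> g r c = 0].

(* The intersection of the standard parabolic with its opposite. *)
Definition levi I : set 'M[R[i]]_n :=
  [set g | parabolic I g /\ parabolic I g^T].

Definition levi_borel I : set 'M[R[i]]_n := levi I `&` borel.

End Groups.

Arguments levi R n I : clear implicits.
Arguments levi_borel R n I : clear implicits.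

(* A point of GL_n/Q_d is a left coset, i.e. a set of matrices; a subset of
   GL_n/Q_d is a set of such cosets. *)
Section HomogeneousSpace.
Variables (R : realType) (n d : nat).
Implicit Types (X Z U : set (set 'M[R[i]]_n)) (H : set 'M[R[i]]_n).
Implicit Types f : set 'M[R[i]]_n -> R[i].

Definition maxparabolic : set 'M[R[i]]_n := parabolic (Delta n `\ d).

Definition coset (g : 'M[R[i]]_n) : set 'M[R[i]]_n :=
  [set g *m q | q in maxparabolic].

Definition GmodQ : set (set 'M[R[i]]_n) := [set coset g | g in @GL R n].

Definition translate (h : 'M[R[i]]_n) (x : set 'M[R[i]]_n) : set 'M[R[i]]_n :=
  [set h *m g | g in x].

Definition orbit H (x : set 'M[R[i]]_n) : set (set 'M[R[i]]_n) :=
  [set translate h x | h in H].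

Definition stable H X := forall h x, H h -> X x -> X (translate h x).

Definition mxeval (p : {mpoly R[i][n * n]}) (g : 'M[R[i]]_n) : R[i] :=
  p.@[mxvec g 0].

(* The Zariski topology of GL_n/Q_d is the quotient topology from GL_n. *)
Definition zclosed Z :=
  Z `<=` GmodQ /\
  exists S : set {mpoly R[i][n * n]},
    forall g, GL g -> (Z (coset g) <-> forall p, S p -> mxeval p g = 0).

Definition zopen U := U `<=` GmodQ /\ zclosed (GmodQ `\` U).

Definition zclosure Z : set (set 'M[R[i]]_n) :=
  \bigcap_(F in [set F | zclosed F /\ Z `<=` F]) F.

Definition irreducible Z :=
  Z !=set0 /\
  forall F1 F2, zclosed F1 -> zclosed F2 -> Z `<=` F1 `|` F2 ->
    Z `<=` F1 \/ Z `<=` F2.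

Definition closed_subvariety Z := zclosed Z /\ irreducible Z.

Definition codim1 Z X :=
  Z `<` X /\ ~ exists Y, [/\ closed_subvariety Y, Z `<` Y & Y `<` X].

Definition prime_divisor D X := closed_subvariety D /\ codim1 D X.

(* Regular functions on an open U of GL_n/Q_d are those whose pullback to GL_n
   is locally a quotient of polynomials in the matrix entries; the nonvanishing
   loci of such denominators form a basis of neighbourhoods. *)
Definition regular U f :=
  forall g, GL g -> U (coset g) ->
  exists p q, mxeval q g != 0 /\
    forall h, GL h -> U (coset h) -> mxeval q h != 0 ->
      f (coset h) = mxeval p h / mxeval q h.

(* Regular functions on the open subset X `&` U of the closed subvariety X. *)
Definition regular_sub X U f :=
  forall x, X x -> U x ->
  exists V g, [/\ zopen V, V x, regular V g &
    forall y, X y -> U y -> V y -> f y = g y].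

(* At every point x of X the local ring is integrally closed in the function
   field: a rational function f, regular on X `&` U, which satisfies a monic
   equation with coefficients c regular near x, is itself regular near x. *)
Definition normal X :=
  forall x U f, X x -> zopen U -> X `&` U !=set0 -> regular_sub X U f ->
  forall V (m : nat) (c : 'I_m -> set 'M[R[i]]_n -> R[i]),
    zopen V -> V x -> (forall k, regular_sub X V (c k)) ->
    (forall y, X y -> U y -> V y ->
       f y ^+ m + \sum_(k < m) c k y * f y ^+ k = 0) ->
  exists W g, [/\ zopen W, W x, regular_sub X W g &
    forall y, X y -> U y -> W y -> f y = g y].

(* In the next two definitions BH is a Borel subgroup of H. *)
Definition spherical H (BH : set 'M[R[i]]_n) X :=
  [/\ closed_subvariety X, stable H X, normal X &
    exists x U, [/\ X x, zopen U & orbit BH x = X `&` U]].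

Definition toroidal H (BH : set 'M[R[i]]_n) X :=
  spherical H BH X /\
  ~ exists D, [/\ prime_divisor D X, stable BH D, ~ stable H D &
      exists2 x, X x & orbit H x `<=` D].

(* The matrix sending the basis vector e_c to e_{w c}. *)
Definition permutation_matrix (w : 'S_n) : 'M[R[i]]_n :=
  \matrix_(r, c) (r == w c)%:R.

Definition schubert_variety (w : 'S_n) : set (set 'M[R[i]]_n) :=
  zclosure (orbit (@borel R n) (coset (permutation_matrix w))).

Definition grassmann_perm (w : 'S_n) :=
  (forall r s : 'I_n, (r < s < d)%N -> (w r < w s)%N) /\
  (forall r s : 'I_n, (d <= r < s)%N -> (w r < w s)%N).

Definition schubert_subvariety Z X :=
  Z `<=` X /\ exists v, grassmann_perm v /\ Z = schubert_variety v.

Definition schubert_divisor D X := schubert_subvariety D X /\ codim1 D X.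

End HomogeneousSpace.

Arguments schubert_variety R {n} d w.

(* The first d entries of w, with values in {1, ..., n}, are the concatenation
   of the runs a_l, a_l + 1, ..., a_l + b_l for 1 <= l <= j. *)
Definition one_line_runs (n d : nat) (w : 'S_n) (j : nat) (a b : nat -> nat) :=
  take d [seq (val (w k)).+1 | k <- enum 'I_n] =
    flatten [seq iota (a l) (b l).+1 | l <- iota 1 j] /\
  forall l, (1 <= l < j)%N -> (a l + b l + 1 < a l.+1)%N.

(* Exchanges the values k and k + 1 of {1, ..., n}, for 1 <= k < n. *)
Definition simple_transp (n k : nat) : 'S_n :=
  if (insub k.-1 : option 'I_n, insub k : option 'I_n) is (Some x, Some y)
  then tperm x y else 1%g.

(* (s * t) x = t (s x) in 'S_n, so this exchanges the values a - 1 and a. *)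
Definition lower_entry (n : nat) (w : 'S_n) (a : nat) : 'S_n :=
  (w * simple_transp n a.-1)%g.

(* Main.v *)
Require Import Defs.

Local Open Scope classical_set_scope.

(** If [a_l - 1] lies in [I], the transposition of [a_l - 1] and [a_l] belongs
    to [L_I] and exchanges the torus-fixed points [w_l] and [w], so the Schubert
    divisor [X_{w_l}] is a Borel-stable prime divisor which is not [L_I]-stable.
    An [L_I]-stable Schubert subvariety of [X_{w_l}] would contain an orbit of
    [L_I], against toroidality. *)

Section SchubertVarieties.

Set Implicit Arguments.
Unset Strict Implicit.

Import GRing.Theory Num.Theory.
Local Open Scope ring_scope.

Variable R : realType.
Local Notation C := R[i].

(** * Polynomial functions on matrices *)

Lemma ex_nonroot (q : {poly C}) : q != 0 -> exists t, q.[t] != 0.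
Proof.
move=> q0; apply: contrapT => H.
(* In characteristic zero these are [size q] distinct points, more than the degree of [q]. *)
have allroot : all (root q) [seq k%:R | k <- iota 0 (size q)].
  apply/allP => t _; apply/rootP/eqP; apply: contrapT => /negP qt.
  by apply: H; exists t.
have := max_poly_roots q0 allroot.
rewrite size_map size_iota ltnn => H'; apply: notF; apply: H'.
by rewrite map_inj_uniq ?iota_uniq //; move=> x y /eqP; rewrite eqr_nat => /eqP.
Qed.

Lemma mxeval_line n (p : {mpoly C[n * n]}) (g v : 'M[C]_n) :
  exists q : {poly C}, forall t, q.[t] = mxeval p (g + t *: v).
Proof.
exists (\sum_(m <- msupp p) (p@_m)%:P *
          \prod_i ((mxvec g 0 i)%:P + (mxvec v 0 i)%:P * 'X) ^+ m i) => t.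
rewrite /mxeval mevalE horner_sum; apply: eq_bigr => m _.
rewrite hornerM hornerC horner_prod; congr (_ * _); apply: eq_bigr => i _.
by rewrite horner_exp hornerD hornerM !hornerC hornerX linearD linearZ !mxE
  [t * _]mulrC.
Qed.

Lemma det_line n (g v : 'M[C]_n) :
  exists q : {poly C}, forall t, q.[t] = \det (g + t *: v).
Proof.
exists (\det (\matrix_(r, c) ((g r c)%:P + (v r c)%:P * 'X))) => t.
rewrite -horner_evalE -det_map_mx; congr (\det _); apply/matrixP => r c.
by rewrite !mxE /= /horner_eval hornerD hornerM !hornerC hornerX [t * _]mulrC.
Qed.

(** The entries of [h *m g] are linear forms in those of [g], to be substituted into [p]. This makes
    left translations continuous. *)
Lemma mxeval_mull n (p : {mpoly C[n * n]}) (h : 'M[C]_n) :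
  exists q : {mpoly C[n * n]}, forall g, mxeval q g = mxeval p (h *m g).
Proof.
have coord (i : 'I_(n * n)) :
    exists q : {mpoly C[n * n]}, forall g, mxeval q g = mxvec (h *m g) 0 i.
  case/mxvec_indexP: i => r c.
  exists (\sum_k (h r k)%:MP * 'X_(mxvec_index k c)) => g.
  rewrite mxvecE mxE /mxeval raddf_sum; apply: eq_bigr => k _ /=.
  by rewrite rmorphM /= mevalC mevalXU mxvecE.
have [f fE] := choice coord.
exists (p \mPo [tuple f i | i < n * n]) => g.
rewrite /mxeval comp_mpoly_meval; apply: meval_eq => i.
by rewrite tnth_mktuple -fE.
Qed.

Variables n d : nat.
Implicit Types (g h : 'M[C]_n) (Z F : set (set 'M[C]_n)).
Local Notation coset := (@coset R n d).
Local Notation GmodQ := (@GmodQ R n d).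
Local Notation zclosed := (@zclosed R n d).
Local Notation zclosure := (@zclosure R n d).
Local Notation borel := (@borel R n).
Local Notation pmx := (@permutation_matrix R n).

(** * Zariski topology of the quotient and Borel orbits *)

Lemma GLM g h : GL g -> GL h -> GL (g *m h).
Proof. by rewrite /GL /= unitmx_mul => -> ->. Qed.

Lemma borelM g h : borel g -> borel h -> borel (g *m h).
Proof.
move=> [Gg Bg] [Gh Bh]; split=> [|r c cr]; first exact: GLM.
rewrite mxE big1 // => k _; have [kr|rk] := ltnP k r.
  by rewrite Bg // mul0r.
by rewrite Bh ?mulr0 // (leq_trans cr).
Qed.

Lemma borel1 : borel 1%:M.
Proof.
split=> [|r c cr]; first exact: unitmx1.
by rewrite mxE -val_eqE gtn_eqF.
Qed.

Lemma translate_coset h g : translate h (coset g) = coset (h *m g).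
Proof.
apply/seteqP; split => [_ [_ [q Qq <-] <-]|_ [q Qq <-]].
  by exists q; rewrite // mulmxA.
by exists (g *m q); [exists q|rewrite mulmxA].
Qed.

Lemma zclosed_GmodQ : zclosed GmodQ.
Proof. by split=> //; exists set0 => g Gg; split=> // _; exists g. Qed.

Lemma sub_zclosure Z : Z `<=` zclosure Z.
Proof. by move=> x Zx F [_]; apply. Qed.

Lemma zclosure_min Z F : zclosed F -> Z `<=` F -> zclosure Z `<=` F.
Proof. by move=> cF ZF x; apply. Qed.

Lemma zclosed_zclosure Z : Z `<=` GmodQ -> zclosed (zclosure Z).
Proof.
move=> ZG; split; first exact: zclosure_min zclosed_GmodQ ZG.
(* The equations of all closed sets [F] containing [Z] are pooled, so that their common zeros form
   the intersection of these sets. *)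
exists [set p | exists F, [/\ zclosed F, Z `<=` F &
                 forall g, GL g -> F (coset g) -> mxeval p g = 0]] => g Gg.
split=> [Zg p [F [cF ZF]]|H F [cF ZF]]; first by apply=> //; apply: Zg.
have [_ [S SE]] := cF; apply/SE => // p Sp.
by apply: H; exists F; split=> // h Gh /SE-/(_ Gh); apply.
Qed.

Lemma zclosed_translate h F : GL h -> zclosed F ->
  zclosed [set x | GmodQ x /\ F (translate h x)].
Proof.
move=> Gh [FG [S SE]]; split; first by move=> x [].
exists [set q | exists2 p, S p & forall g, mxeval q g = mxeval p (h *m g)] => g Gg.
split=> [[_ +] q [p Sp ->]|H].
  by rewrite translate_coset => /SE; apply=> //; apply: GLM.
split; first by exists g.
rewrite translate_coset; apply/SE; first exact: GLM.
by move=> p Sp; have [q qE] := mxeval_mull p h; rewrite -qE; apply: H; exists p.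
Qed.

(** For [h] in [H] and a closed [F] containing [Z], the preimage of [F] under translation by [h] is
    closed and contains [Z], hence also its closure. *)
Lemma stable_zclosure (H : set 'M[C]_n) Z :
  H `<=` @GL R n -> Z `<=` GmodQ -> stable H Z -> stable H (zclosure Z).
Proof.
move=> HG ZG HZ h x Hh Zx F [cF ZF].
have [] // : [set x | GmodQ x /\ F (translate h x)] x.
apply: Zx; split; first by apply: zclosed_translate => //; apply: HG.
by move=> y Zy; split; [apply: ZG|apply: ZF; apply: HZ].
Qed.

Lemma irreducible_zclosure Z : irreducible d Z -> irreducible d (zclosure Z).
Proof.
move=> [[x Zx] Zirr]; split; first by exists x; apply: sub_zclosure.
move=> F1 F2 c1 c2 ZF.
by have [] := Zirr F1 F2 c1 c2 (subset_trans (@sub_zclosure Z) ZF);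
  [left|right]; apply: zclosure_min.
Qed.

(* Two elements of the Borel subgroup are joined by a line all but finitely many
   of whose points are in the Borel subgroup. *)
Lemma irreducible_borel_orbit g : GL g -> irreducible d (orbit borel (coset g)).
Proof.
move=> Gg; split.
  by exists (translate 1%:M (coset g)), 1%:M => //; exact: borel1.
move=> F1 F2 [_ [S1 S1E]] [_ [S2 S2E]] BF; apply: contrapT => /not_orP[].
(* An orbit not inside [F] has a point at which some equation of [F] does not vanish. *)
have outside F S :
    (forall h, GL h -> F (coset h) <-> forall p, S p -> mxeval p h = 0) ->
    ~ orbit borel (coset g) `<=` F ->
    exists b p, [/\ borel b, S p & mxeval p (b *m g) != 0].
  move=> SE nF; apply: contrapT => H; apply: nF => _ [b Bb <-].
  rewrite translate_coset; apply/SE; first by apply: GLM => //; case: Bb.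
  move=> p Sp; apply/eqP; apply: contrapT => /negP ne0.
  by apply: H; exists b, p.
move=> /(outside _ _ S1E)[b1 [p1 [B1 Sp1 ne1]]].
move=> /(outside _ _ S2E)[b2 [p2 [B2 Sp2 ne2]]].
pose b t := b1 + t *: (b2 - b1).
have b0E : b 0 = b1 by rewrite /b scale0r addr0.
have b1E : b 1 = b2 by rewrite /b scale1r addrC subrK.
have lineE t : b1 *m g + t *: ((b2 - b1) *m g) = b t *m g.
  by rewrite scalemxAl -mulmxDl.
have [q1 q1E] := mxeval_line p1 (b1 *m g) ((b2 - b1) *m g).
have [q2 q2E] := mxeval_line p2 (b1 *m g) ((b2 - b1) *m g).
have [q3 q3E] := det_line b1 (b2 - b1).
(* Along the line, [q1] and the determinant [q3] are nonzero at 0 and [q2] at 1. Where their product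
   is nonzero, the point lies in the orbit but in neither [F1] nor [F2]. *)
have q1_neq0 : q1 != 0.
  by apply: contra_neq ne1 => q10; rewrite -b0E -lineE -q1E q10 horner0.
have q2_neq0 : q2 != 0.
  by apply: contra_neq ne2 => q20; rewrite -b1E -lineE -q2E q20 horner0.
have q3_neq0 : q3 != 0.
  have : \det b1 != 0 by rewrite -unitfE; case: B1.
  by apply: contra_neq => q30; rewrite -b0E -q3E q30 horner0.
have [t] : exists t, (q1 * q2 * q3).[t] != 0.
  by apply: ex_nonroot; rewrite !mulf_neq0.
rewrite !hornerM !mulf_eq0 !negb_or q1E q2E q3E !lineE -/(b t).
move=> /andP[/andP[/eqP t1 /eqP t2] t3].
have Bt : borel (b t).
  split=> [|r c cr]; first by rewrite /GL /= unitmxE unitfE.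
  by rewrite !mxE B1.2 // B2.2 // subr0 mulr0 addr0.
have Gt : GL (b t *m g) by apply: GLM => //; case: Bt.
have := BF (coset (b t *m g)).
rewrite -translate_coset => /(_ (ex_intro2 _ _ _ Bt erefl)).
by rewrite translate_coset => -[/S1E-/(_ Gt) /(_ _ Sp1)|/S2E-/(_ Gt) /(_ _ Sp2)].
Qed.

(** The ones of [perm_mx s] are at [(r, s r)], those of [permutation_matrix w] at [(w c, c)], whence
    the inverse. *)
Lemma permutation_matrixE (w : 'S_n) : pmx w = perm_mx w^-1.
Proof. by apply/matrixP => r c; rewrite !mxE eq_sym (canF_eq (permK w)) eq_sym. Qed.

Lemma GL_permutation_matrix (w : 'S_n) : GL (pmx w).
Proof. by rewrite permutation_matrixE; apply: unitmx_perm. Qed.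

Lemma permutation_matrixM (s t : 'S_n) : pmx (s * t) = pmx t *m pmx s.
Proof. by rewrite !permutation_matrixE invMg perm_mxM. Qed.

Lemma borel_orbit_sub_GmodQ g : GL g -> orbit borel (coset g) `<=` GmodQ.
Proof.
move=> Gg _ [b [Gb _] <-]; rewrite translate_coset.
by exists (b *m g) => //; apply: GLM.
Qed.

Lemma stable_borel_orbit g : stable borel (orbit borel (coset g)).
Proof.
move=> h _ Bh [b Bb <-]; exists (h *m b); first exact: borelM.
by rewrite !translate_coset mulmxA.
Qed.

(** * Schubert varieties *)

Lemma schubert_variety_closed_subvariety (w : 'S_n) :
  closed_subvariety d (schubert_variety R d w).
Proof.
split; first exact/zclosed_zclosure/borel_orbit_sub_GmodQ/GL_permutation_matrix.
exact/irreducible_zclosure/irreducible_borel_orbit/GL_permutation_matrix.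
Qed.

Lemma stable_borel_schubert_variety (w : 'S_n) :
  stable borel (schubert_variety R d w).
Proof.
apply: stable_zclosure; first by move=> g [].
  exact/borel_orbit_sub_GmodQ/GL_permutation_matrix.
exact: stable_borel_orbit.
Qed.

Lemma mem_schubert_variety (w : 'S_n) : schubert_variety R d w (coset (pmx w)).
Proof.
apply: sub_zclosure; exists 1%:M; first exact: borel1.
by rewrite translate_coset mul1mx.
Qed.

(** A closed Borel-stable set containing a point contains the closure of its Borel orbit, so
    inclusion is tested at one torus-fixed point. *)
Lemma schubert_variety_sub (v w : 'S_n) :
  schubert_variety R d v (coset (pmx w)) ->
  schubert_variety R d w `<=` schubert_variety R d v.
Proof.
move=> vw; apply: zclosure_min.
  by have [] := schubert_variety_closed_subvariety v.
by move=> _ [b Bb <-]; apply: stable_borel_schubert_variety.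
Qed.

(** * Simple transpositions in the Levi subgroup *)

Lemma simple_transp_out k : (n <= k)%N -> simple_transp n k = 1%g.
Proof.
by move=> nk; rewrite /simple_transp [insub k]insubF ?ltnNge ?nk //; case: insub.
Qed.

Lemma simple_transpE k (x y : 'I_n) :
  val x = k.-1 -> val y = k -> simple_transp n k = tperm x y.
Proof. by move=> xk yk; rewrite /simple_transp -xk -yk !valK. Qed.

Lemma simple_transp_sqr k : (simple_transp n k * simple_transp n k = 1)%g.
Proof.
rewrite /simple_transp; case: insub => [x|]; last exact: mulg1.
by case: insub => [y|]; [exact: tperm2|exact: mulg1].
Qed.

(** The only nonzero entry below the diagonal is at [(k, k.-1)], in the root space of the negative
    of the simple root [k] of [I]. The matrix is symmetric, so the opposite parabolic needs no
    second computation. *)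
Lemma levi_simple_transp (I : set nat) k :
  I k -> (0 < k < n)%N -> levi R n I (pmx (simple_transp n k)).
Proof.
move=> Ik /andP[k0 kn].
have k1n : (k.-1 < n)%N by rewrite (leq_ltn_trans (leq_pred k)).
rewrite (@simple_transpE k (Ordinal k1n) (Ordinal kn)) //.
set x := Ordinal k1n; set y := Ordinal kn.
have symm : (pmx (tperm x y))^T = pmx (tperm x y).
  by rewrite !permutation_matrixE tr_perm_mx invgK tpermV.
suff P : parabolic I (pmx (tperm x y)) by split; rewrite ?symm.
split=> [|r c cr [m /andP[cm mr] nIm]]; first exact: GL_permutation_matrix.
rewrite mxE; case: eqP => // rE; case: nIm.
move: rE; case: tpermP => [cE rE|cE rE|_ _ rE].
(* Here [k.-1 < m <= k] forces [m = k], which lies in [I]. The other two cases are above or on the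
   diagonal. *)
- move: cm mr; rewrite cE rE /= => cm mr; suff -> : m = k by [].
  by apply/eqP; rewrite eqn_leq mr -(prednK k0).
- by move: cr; rewrite cE rE /= ltnNge leq_pred.
- by move: cr; rewrite rE ltnn.
Qed.

End SchubertVarieties.

Theorem corollary6p6 (R : realType) (n d : nat) (I : set nat) (w : 'S_n)
    (j : nat) (a b : nat -> nat)
    (hd : (0 < d < n)%N)
    (hI : I `<=` Delta n)
    (hw : grassmann_perm d w)
    (hw1 : w <> 1%g)
    (hruns : one_line_runs d w j a b)
    (hstable : stable (levi R n I) (schubert_variety R d w))
    (htor : toroidal d (levi R n I) (levi_borel R n I) (schubert_variety R d w)) :
  forall l : nat, (1 <= l <= j)%N -> (1 < a l)%N ->
    schubert_divisor d (schubert_variety R d (lower_entry w (a l)))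
                       (schubert_variety R d w) ->
    (Delta n `\` I) (a l).-1 \/
    (~ (Delta n `\` I) (a l).-1 /\
     ~ exists Z, schubert_subvariety d Z
                   (schubert_variety R d (lower_entry w (a l))) /\
                 stable (levi R n I) Z).
Proof.
move=> l _ al1 [_ Dcodim]; have [XD _] := Dcodim.
have [?|notDI] := pselect ((Delta n `\` I) (a l).-1); [by left|right; split=> //].
move=> [Z [[ZD [v [_ ZE]]] stabZ]].
have [DX notXD] := XD.
set k := (a l).-1 in notDI; have k0 : (0 < k)%N by rewrite -ltnS prednK // ltnW.
(* For [n <= k] the transposition defaults to the identity, and the divisor would be the whole
   variety. *)
have kn : (k < n)%N.
  rewrite ltnNge; apply/negP => nk; apply: notXD.
  by rewrite /lower_entry simple_transp_out // mulg1.
have Ik : I k by apply: contrapT => nIk; apply: notDI; split=> //; apply/andP.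
have Zv : Z (coset d (permutation_matrix R v)).
  by rewrite ZE; apply: mem_schubert_variety.
have [_] := htor; apply.
exists (schubert_variety R d (lower_entry w (a l))); split.
- by split=> //; apply: schubert_variety_closed_subvariety.
- by move=> h x [_ Bh]; apply: stable_borel_schubert_variety.
(* Stability would bring the fixed point of [w] into the divisor, hence all of its Schubert variety,
   against proper inclusion. *)
- move=> stabD; apply: notXD; apply: (@schubert_variety_sub R n d).
  have kI : (0 < k < n)%N by apply/andP.
  have := stabD _ _ (levi_simple_transp R Ik kI)
    (@mem_schubert_variety R n d (lower_entry w (a l))).
  rewrite translate_coset -permutation_matrixM /lower_entry -mulgA.
  by rewrite simple_transp_sqr mulg1.
(* The orbit of the fixed point of [v] stays in the stable [Z], hence in the divisor. *)
- exists (coset d (permutation_matrix R v)); first exact: (DX _ (ZD _ Zv)).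
  by move=> _ [h Lh <-]; apply: ZD; apply: stabZ.
Qed.
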